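(* Let $m\ge 2$ and $G= Q_{4m} = \langle x, y : x^{2m} = 1,\ x^m = y^2,\ y^{-1}xy = x^{-1}\rangle$. (1) If $m= 2,3,4$ then $\mathcal{CCC}(G)$ is neither hyperenergetic, borderenergetic, L-hyperenergetic, L-borderenergetic, Q-hyperenergetic nor Q-borderenergetic. (2) If $m=5$ then $\mathcal{CCC}(G)$ is L-borderenergetic but neither hyperenergetic, borderenergetic, L-hyperenergetic, Q-hyperenergetic nor Q-borderenergetic. (3) If $m=6,7$ then $\mathcal{CCC}(G)$ is L-hyperenergetic but neither hyperenergetic, borderenergetic, L-borderenergetic, Q-hyperenergetic nor Q-borderenergetic. (4) If $m\geq 8$ then $\mathcal{CCC}(G)$ is L-hyperenergetic and Q-hyperenergetic but neither hyperenergetic, borderenergetic, L-borderenergetic nor Q-borderenergetic.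
   Context: For a finite non-abelian group $G$, the commuting conjugacy class graph $\mathcal{CCC}(G)$ is the simple undirected graph whose vertices are the conjugacy classes of the non-central elements of $G$; two distinct vertices $x^G$ and $y^G$ are adjacent iff there exist $x'\in x^G$ and $y'\in y^G$ with $x'y'=y'x'$. For a finite graph $\mathcal{G}$ with adjacency matrix $A(\mathcal{G})$ and (diagonal) degree matrix $D(\mathcal{G})$, put $L(\mathcal{G})=D(\mathcal{G})-A(\mathcal{G})$ and $Q(\mathcal{G})=D(\mathcal{G})+A(\mathcal{G})$, and let $\mathrm{Spec}(\mathcal{G})$, $\mathrm{L\text{-}Spec}(\mathcal{G})$, $\mathrm{Q\text{-}Spec}(\mathcal{G})$ be the multisets of eigenvalues of $A(\mathcal{G})$, $L(\mathcal{G})$, $Q(\mathcal{G})$. With $d=\frac{2|e(\mathcal{G})|}{|V(\mathcal{G})|}$ (twice the number of edges over the number of vertices), put $E(\mathcal{G})=\sum_{\lambda\in \mathrm{Spec}(\mathcal{G})}|\lambda|$, $LE(\mathcal{G})=\sum_{\mu\in \mathrm{L\text{-}Spec}(\mathcal{G})}|\mu-d|$, $LE^+(\mathcal{G})=\sum_{\nu\in \mathrm{Q\text{-}Spec}(\mathcal{G})}|\nu-d|$ (sums with multiplicity). Let $\mathcal{G}$ have $N$ vertices and let $K_N$ be the complete graph on $N$ vertices (for which $E(K_N)=LE(K_N)=LE^+(K_N)=2(N-1)$). $\mathcal{G}$ is hyperenergetic, L-hyperenergetic or Q-hyperenergetic according as $E(K_N)<E(\mathcal{G})$, $LE(K_N)<LE(\mathcal{G})$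 or $LE^+(K_N)<LE^+(\mathcal{G})$; it is borderenergetic, L-borderenergetic or Q-borderenergetic according as $E(K_N)=E(\mathcal{G})$, $LE(K_N)=LE(\mathcal{G})$ or $LE^+(K_N)=LE^+(\mathcal{G})$. *)

(* Defs.v *)
From HB Require Import structures.
From mathcomp Require Export all_boot all_order all_algebra all_fingroup.
From mathcomp Require Export all_solvable all_field.

Set Implicit Arguments.
Unset Strict Implicit.
Unset Printing Implicit Defensive.

Import Order.TTheory GRing.Theory Num.Theory.
Local Open Scope ring_scope.

Record sgraph := SGraph {
  vertex :> finType;
  adj : rel vertex;
  adj_sym : symmetric adj;
  adj_irr : irreflexive adj }.

Section Spectra.

Variable Gr : sgraph.

Definition edge_set : {set {set Gr}} :=
  [set [set u.1; u.2] | u : Gr * Gr & adj u.1 u.2].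

Definition degree (u : Gr) : nat := #|[set v | adj u v]|.

Definition adj_mx : 'M[algC]_#|Gr| :=
  \matrix_(i, j) (adj (enum_val i) (enum_val j))%:R.

Definition deg_mx : 'M[algC]_#|Gr| :=
  diag_mx (\row_i (degree (enum_val i))%:R).

Definition laplacian_mx : 'M[algC]_#|Gr| := deg_mx - adj_mx.

Definition signless_laplacian_mx : 'M[algC]_#|Gr| := deg_mx + adj_mx.

End Spectra.

(* Roots of the characteristic polynomial in algC, listed with algebraic
   multiplicity; the order of the list is irrelevant below. *)
Definition eigenvalues n (A : 'M[algC]_n) : seq algC :=
  sval (closed_field_poly_normal (char_poly A)).

Lemma eigenvaluesP n (A : 'M[algC]_n) :
  char_poly A = \prod_(z <- eigenvalues A) ('X - z%:P).
Proof.
rewrite /eigenvalues; case: closed_field_poly_normal => r /= {1}->.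
by rewrite (monicP (char_poly_monic A)) scale1r.
Qed.

Section Energies.

Variable Gr : sgraph.

Definition Spec : seq algC := eigenvalues (adj_mx Gr).
Definition L_Spec : seq algC := eigenvalues (laplacian_mx Gr).
Definition Q_Spec : seq algC := eigenvalues (signless_laplacian_mx Gr).

Definition avg_degree : algC := (2 * #|edge_set Gr|)%N%:R / #|Gr|%:R.

Definition energy : algC := \sum_(x <- Spec) `|x|.
Definition L_energy : algC := \sum_(x <- L_Spec) `|x - avg_degree|.
Definition Q_energy : algC := \sum_(x <- Q_Spec) `|x - avg_degree|.

End Energies.

Section Complete.

Variable N : nat.

Definition complete_adj : rel 'I_N := fun i j => i != j.

Lemma complete_adj_sym : symmetric complete_adj.
Proof. by move=> i j; rewrite /complete_adj eq_sym. Qed.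

Lemma complete_adj_irr : irreflexive complete_adj.
Proof. by move=> i; rewrite /complete_adj eqxx. Qed.

Definition complete_graph : sgraph := SGraph complete_adj_sym complete_adj_irr.

End Complete.

(* Energies are sums of norms, hence nonnegative reals, so the partial order of
   algC is total on them and negated strict inequalities have their usual
   meaning. *)
Section Hyperenergetic.

Variable Gr : sgraph.

Let K : sgraph := complete_graph #|Gr|.

Definition hyperenergetic : Prop := energy K < energy Gr.
Definition L_hyperenergetic : Prop := L_energy K < L_energy Gr.
Definition Q_hyperenergetic : Prop := Q_energy K < Q_energy Gr.

Definition borderenergetic : Prop := energy K = energy Gr.
Definition L_borderenergetic : Prop := L_energy K = L_energy Gr.
Definition Q_borderenergetic : Prop := Q_energy K = Q_energy Gr.

End Hyperenergetic.

Section CommutingConjugacyClassGraph.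

Local Open Scope group_scope.

Variables (gT : finGroupType) (G : {group gT}).

Definition noncentral_classes : {set {set gT}} :=
  [set x ^: G | x in G :\: 'Z(G)].

Definition ccc_vertex : finType := {C : {set gT} | C \in noncentral_classes}.

Definition ccc_adj : rel ccc_vertex := fun C D =>
  (C != D) && [exists x in val C, exists y in val D, x * y == y * x].

Lemma ccc_adj_sym : symmetric ccc_adj.
Proof.
move=> C D; rewrite /ccc_adj eq_sym; congr (_ && _).
by apply/exists_inP/exists_inP => -[x xC /exists_inP[y yD /eqP xy]];
   exists y => //; apply/exists_inP; exists x => //; apply/eqP.
Qed.

Lemma ccc_adj_irr : irreflexive ccc_adj.
Proof. by move=> C; rewrite /ccc_adj eqxx. Qed.

Definition CCC : sgraph := SGraph ccc_adj_sym ccc_adj_irr.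

End CommutingConjugacyClassGraph.

(* In MathComp [x ^ y] is y^-1 * x * y, and G is a finite group isomorphic to
   the largest finite quotient of the presented group, which is the presented
   group itself since the latter has order 4m (for m >= 1). *)
Definition is_dicyclic (gT : finGroupType) (G : {group gT}) (m : nat) : Prop :=
  (G \isog Grp (x : y : x ^+ (2 * m)%N, x ^+ m = y ^+ 2, x ^ y = x^-1))%g.

(* Main.v *)
(* CCC(Q_4m) has the classes {x^i, x^-i} for 0 < i < m, forming a clique, and
   the classes of y and xy; these last two are isolated from the clique, and
   are joined to each other exactly when m is odd.  Each of the matrices A, L, Q
   of such a graph is block diagonal with blocks of the form a I + b J, so all
   its eigenvalues are rational; the energies are then compared in rat, using
   p = m - 2 as parameter.  That |Q_4m| = 4m is seen on the explicit group
   Z/2m x {0, 1}, where (i, b) stands for x^i y^b. *)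
From HB Require Import structures.
Require Import Defs.
From mathcomp Require Import ring lra zify.

Set Implicit Arguments.
Unset Strict Implicit.
Unset Printing Implicit Defensive.

Import Order.TTheory GRing.Theory Num.Theory.

(** * The group Q_4m *)

Lemma odd_modn_double n p : odd (n %% (2 * p)) = odd n.
Proof. by rewrite [in RHS](divn_eq n (2 * p)) oddD !oddM andbF. Qed.

(** * An explicit group of order 4m satisfying the relations *)

Section DicyclicModel.

Variable n : nat.

(** Here m is [n.+1], so the modulus is at least 2 and ['Z_] really has that many elements. *)
Definition dic_model : Type := ('Z_(2 * n.+1) * bool)%type.

HB.instance Definition _ := Finite.on dic_model.

Local Open Scope ring_scope.

Let h : 'Z_(2 * n.+1) := n.+1%:R.

Let hN : - h = h.
Proof.
apply/eqP; rewrite eq_sym -addr_eq0; apply/eqP.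
by rewrite -natrD addnn -mul2n pchar_Zp // mul2n -addnn addnS.
Qed.

(** Normal form of x^i y^b x^j y^c: moving y past x^j inverts x^j, and y^2 = x^m contributes [h]. *)
Definition dic_mul (u v : dic_model) : dic_model :=
  (u.1 + (if u.2 then - v.1 else v.1) + (if u.2 && v.2 then h else 0),
   u.2 (+) v.2).

Definition dic_one : dic_model := (0, false).

(** Since y^-1 = x^m y, the inverse of x^i y is x^i y^-1 = x^(i+m) y. *)
Definition dic_inv (u : dic_model) : dic_model :=
  if u.2 then (u.1 + h, true) else (- u.1, false).

Lemma dic_mulA : associative dic_mul.
Proof.
move=> [i b] [j c] [k d]; rewrite /dic_mul /= addbA; congr pair.
by case: b c d => -[] [] /=; rewrite ?opprD ?hN; ring.
Qed.

Lemma dic_mul1 : left_id dic_one dic_mul.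
Proof. by case=> i b; rewrite /dic_mul /= add0r addr0. Qed.

Lemma dic_mulV : left_inverse dic_one dic_inv dic_mul.
Proof.
case=> i [] /=; rewrite /dic_mul /dic_one /=; congr pair; last by ring.
by rewrite -{2}hN; ring.
Qed.

HB.instance Definition _ :=
  Finite_isGroup.Build dic_model dic_mulA dic_mul1 dic_mulV.

Local Open Scope group_scope.

Lemma dic_model_homg :
  [set: dic_model] \homg
    Grp (x : y : x ^+ (2 * n.+1)%N, x ^+ n.+1 = y ^+ 2, x ^ y = x^-1).
Proof.
pose x : dic_model := (1%R, false); pose y : dic_model := (0%R, true).
have xX k : x ^+ k = (k%:R%R, false).
  elim: k => // k IHk; rewrite expgS IHk.
  by congr pair; rewrite /= addr0 -mulrS.
apply/existsP; exists (x, y); rewrite /= !xpair_eqE /=; apply/and4P; split.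
- rewrite eqEsubset subsetT /=; apply/subsetP=> -[i b] _.
  have -> : (i, b) = x ^+ (i : nat) * y ^+ b.
    rewrite xX; case: b; rewrite ?mulg1; congr pair;
      rewrite /= ?Zp_cast ?natr_Zp //.
    by rewrite addr0 addr0.
  by apply: groupM; rewrite groupX // mem_gen // inE cycle_id ?orbT.
- by rewrite xX pchar_Zp; [exact: eqxx | rewrite mulnS].
- rewrite xX; apply/eqP; congr pair; rewrite /=; ring.
suff /eqP: x ^ y = x^-1 by [].
by apply: (mulgI y); rewrite conjgE mulKVg; congr pair; rewrite /=; ring.
Qed.

Lemma card_dic_model : #|[set: dic_model]| = (4 * n.+1)%N.
Proof. by rewrite cardsT card_prod card_ord card_bool Zp_cast; lia. Qed.

End DicyclicModel.

(** * Conjugacy classes and commutation in Q_4m *)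

Section Dicyclic.

Local Open Scope group_scope.

Variables (gT : finGroupType) (G : {group gT}).

(** The relations alone make G the union of <x> and <x>y with the order of x dividing 2m, so |G| <=
    4m. The model is a homomorphic image of G, so |G| >= 4m; this forces the order of x to be
    exactly 2m and y to lie outside <x>. *)
Lemma dicyclic_generators m : 0 < m -> is_dicyclic G m ->
  exists x y, [/\ #[x] = (2 * m)%N, y \notin <[x]>, x ^ y = x^-1 &
                 G :=: <[x]> :|: <[x]> :* y].
Proof.
move=> m_gt0 isoG.
have leG : 4 * m <= #|G|.
  case: m m_gt0 isoG => // n _ isoG; rewrite -card_dic_model leq_homg //.
  by rewrite isoG dic_model_homg.
have /existsP[[x y] /= /eqP[]] := isoGrp_hom isoG => defG x2m xm_y2 xy.
have ox : #[x] %| 2 * m by rewrite order_dvdn x2m.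
have {}defG : G :=: <[x]> :|: <[x]> :* y.
  rewrite -defG norm_joinEr; last first.
    by rewrite cycle_subG; apply/normP; rewrite -cycleJ xy cycleV.
  apply/setP=> z; apply/mulsgP/setUP => [[u _ ux /cycleP[j ->] ->]|].
    (* As y^2 = x^m, halving j leaves a power of x, times y when j is odd. *)
    rewrite -[j]odd_double_half addnC expgD -mul2n expgM -xm_y2 -expgM.
    rewrite mulgA; case: odd; rewrite ?expg1 ?mulg1; last first.
      by left; rewrite groupM // mem_cycle.
    right; apply/rcosetP; exists (u * x ^+ (m * j./2)) => //.
    by rewrite groupM // mem_cycle.
  case=> [zx|/rcosetP[u ux ->]].
    by exists z 1; rewrite ?mulg1.
  by exists u y; rewrite ?cycle_id.
have yNx : y \notin <[x]>.
  apply/negP=> yx; have: #|G| <= #[x].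
    by rewrite defG rcoset_id // setUid.
  by have := dvdn_leq _ ox; lia.
exists x, y; split=> //.
have: #|G| <= #[x] + #[x].
  by rewrite defG (leq_trans (leq_card_setU _ _)) // card_rcoset.
by have := dvdn_leq _ ox; lia.
Qed.

Variables (m : nat) (x y : gT).
Hypotheses (m_ge2 : 2 <= m) (ox : #[x] = (2 * m)%N) (yNx : y \notin <[x]>).
Hypotheses (xy : x ^ y = x^-1) (defG : G :=: <[x]> :|: <[x]> :* y).

Lemma dicyclic_cases (P : gT -> Prop) :
  (forall j, P (x ^+ j)) -> (forall j, P (x ^+ j * y)) ->
  forall z, z \in G -> P z.
Proof.
move=> Px Pxy z; rewrite defG => /setUP[/cycleP[j ->] //|].
by case/rcosetP=> _ /cycleP[j ->] ->.
Qed.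

Lemma mem_dicyclic_rot j : x ^+ j \in G.
Proof. by rewrite defG inE mem_cycle. Qed.

Lemma mem_dicyclic_ref j : x ^+ j * y \in G.
Proof. by rewrite defG inE orbC mem_rcoset mulgK mem_cycle. Qed.

Lemma eq_rot i j : (x ^+ i == x ^+ j) = (i == j %[mod 2 * m]).
Proof. by rewrite eq_expg_mod_order ox. Qed.

Lemma rot_neq_ref i j : x ^+ i != x ^+ j * y.
Proof.
apply: contra yNx => /eqP e.
by rewrite -(mulKg (x ^+ j) y) -e groupM // ?groupV mem_cycle.
Qed.

(** With [(2 * m).-1] in the role of -1, exponents can stay natural numbers. *)
Lemma rotV j : (x ^+ j)^-1 = x ^+ ((2 * m).-1 * j).
Proof. by rewrite expgM -ox -invg_expg expgVn. Qed.

Lemma ref_rot j : y * x ^+ j = (x ^+ j)^-1 * y.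
Proof. by rewrite [RHS]conjgC conjVg conjXg xy expgVn invgK. Qed.

Lemma rot_class i z : (z \in x ^+ i ^: G) = (z == x ^+ i) || (z == (x ^+ i)^-1).
Proof.
apply/imsetP/orP => [[g Gg ->] | [] /eqP->]; last 2 first.
- by exists 1; rewrite ?conjg1.
- by exists y; rewrite ?conjXg ?xy ?expgVn // -[y]mul1g (mem_dicyclic_ref 0).
have cx j : x ^+ i ^ x ^+ j = x ^+ i.
  by apply/conjg_fixP/commgP/commuteX2.
elim/dicyclic_cases: Gg => j; rewrite ?conjgM cx ?eqxx; first by left.
by rewrite conjXg xy expgVn eqxx; right.
Qed.

(** Conjugation by x shifts the exponent by an even number and conjugation by y negates it, so the
    parity of the exponent is the only invariant. *)
Lemma ref_class r z :
  reflect (exists k, z = x ^+ (r + 2 * k) * y) (z \in (x ^+ r * y) ^: G).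
Proof.
have cJ k j : (x ^+ k * y) ^ x ^+ j = x ^+ (k + 2 * ((2 * m).-1 * j)) * y.
  rewrite conjgE -mulgA ref_rot rotV !mulgA -!expgD; congr (x ^+ _ * y).
  by move: (_.-1 * j)%N => t; lia.
apply: (iffP imsetP) => [[g Gg ->] | [k ->]]; last first.
  exists (x ^+ ((2 * m).-1 * k)); first exact: mem_dicyclic_rot.
  by rewrite cJ !(mulnCA 2) [in RHS]expgD -!rotV invgK -expgD.
elim/dicyclic_cases: Gg => j; first by rewrite cJ; eexists.
rewrite conjgM cJ; move: (_.-1 * j)%N => b.
(* This witness stands for -(b + r): r - 2(b + r) = -(r + 2b) is the exponent after conjugation by
   y. *)
exists ((2 * m).-1 * (b + r))%N; rewrite conjMg conjXg xy /conjg mulKg expgVn.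
rewrite mulnCA [in RHS]expgD -rotV; congr (_ * y).
apply: (mulIg (x ^+ (2 * (b + r)))).
rewrite mulgKV -[in X in _ * X](_ : r + 2 * b + r = 2 * (b + r))%N; last by lia.
by rewrite [in X in _ * X]expgD mulKg.
Qed.

Lemma rot_nconj_ref i r : x ^+ i \notin (x ^+ r * y) ^: G.
Proof. by apply/ref_class => -[k /eqP]; rewrite (negPf (rot_neq_ref _ _)). Qed.

(** Since y inverts x^i, commuting means x^(2i) = 1. *)
Lemma commute_rot_ref i r :
  (x ^+ i * (x ^+ r * y) == x ^+ r * y * x ^+ i) = (m %| i).
Proof.
rewrite -[X in _ == X]mulgA ref_rot !mulgA (inj_eq (mulIg _)).
rewrite -expgD addnC expgD (inj_eq (mulgI _)) eq_sym eq_invg_mul -expgD.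
by rewrite -[1](expg0 x) eq_rot mod0n addnn -mul2n -/(dvdn _ _) dvdn_pmul2l.
Qed.

(** The products are x^(r-s) y^2 and x^(s-r) y^2, so commuting means 2r = 2s modulo 2m. *)
Lemma commute_ref_ref r s :
  (x ^+ r * y * (x ^+ s * y) == x ^+ s * y * (x ^+ r * y)) = (r == s %[mod m]).
Proof.
rewrite !mulgA -!(mulgA _ y) !ref_rot !mulgA !(inj_eq (mulIg _)).
rewrite -(inj_eq (mulIg (x ^+ (r + s)))) {1}addnC !expgD !mulgA !mulgKV.
by rewrite -!expgD !addnn eq_rot -!mul2n -!muln_modr eqn_pmul2l.
Qed.

Definition dic_rep (k : 'I_m.-1 + 'I_2) : gT :=
  match k with inl i => x ^+ i.+1 | inr r => x ^+ r * y end.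

Lemma dic_rep_noncentral k : dic_rep k \in G :\: 'Z(G).
Proof.
have -> : dic_rep k \in G :\: 'Z(G) =
    (dic_rep k \in G) && ~~ (dic_rep k \in 'C(G)).
  by rewrite in_setD in_setI negb_and andbC; case: (_ \in G).
case: k => [i|r] /=.
  rewrite mem_dicyclic_rot /=; apply/centP => /(_ _ (mem_dicyclic_ref 0))/eqP.
  rewrite commute_rot_ref => /(dvdn_leq (ltn0Sn _)); have := ltn_ord i; lia.
rewrite mem_dicyclic_ref /=; apply/centP => /(_ _ (mem_dicyclic_rot 1))/eqP.
by rewrite eq_sym commute_rot_ref dvdn1; lia.
Qed.

(** The exponents [i.+1] and [j.+1] lie between 1 and m - 1, so their sum is not a multiple of 2m
    and the two powers of x are not inverse to each other. The classes of y and xy are told apart by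
    parity, which survives reduction modulo 2m. *)
Lemma dic_rep_inj k l : dic_rep k \in dic_rep l ^: G -> k = l.
Proof.
case: k l => [i|r] [j|s] /=; last 1 first.
- case/ref_class => k /mulIg/eqP; rewrite eq_rot => /eqP e; congr inr.
  have: odd r = odd s.
    rewrite -[LHS](odd_modn_double _ m) e odd_modn_double.
    by rewrite oddD mul2n odd_double addbF.
  by case: r s {e} => -[|[|r]] //= lr [[|[|s]]] //= ls _; apply: val_inj.
- have [lt_im lt_jm] := (ltn_ord i, ltn_ord j).
  rewrite rot_class => /orP[]/eqP.
    move/eqP; rewrite eq_rot => /eqP; rewrite !modn_small; try lia.
    by move/succn_inj/val_inj->.
  move/esym/eqP; rewrite eq_invg_mul -expgD -[1](expg0 x) eq_rot mod0n.
  by rewrite addSn => /(dvdn_leq (ltn0Sn _)); lia.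
- by rewrite (negPf (rot_nconj_ref _ _)).
by rewrite class_sym (negPf (rot_nconj_ref _ _)).
Qed.

(** A non-central power of x has exponent a modulo 2m other than 0 and m; for a > m its inverse, of
    exponent 2m - a, is the representative. *)
Lemma dic_rep_surj z : z \in G :\: 'Z(G) -> exists k, z \in dic_rep k ^: G.
Proof.
case/setDP=> Gz; elim/dicyclic_cases: z / Gz => j => [xjNZ | _]; last first.
  exists (inr (inord (odd j))); apply/ref_class; exists j./2.
  by rewrite inordK; [rewrite mul2n odd_double_half | case: odd].
have /eqP xj : x ^+ j == x ^+ (j %% (2 * m)) by rewrite eq_rot modn_mod.
have mNj : ~~ (m %| j %% (2 * m)).
  apply: contra xjNZ; rewrite xj => mj; apply/centerP; split.
    exact: mem_dicyclic_rot.
  apply: dicyclic_cases => i; first exact: commuteX2.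
  by apply/eqP; rewrite commute_rot_ref.
have j_lt : j %% (2 * m) < 2 * m by rewrite ltn_pmod; lia.
move: (j %% _) xj mNj j_lt => {xjNZ} a -> mNa a_lt.
have a_gt0 : 0 < a by case: a mNa {a_lt} => //; rewrite dvdn0.
have a_neqm : a != m by apply: contraNneq mNa => ->.
have [a_ltm | m_lta] := ltnP a m.
  have ltk : a.-1 < m.-1 by lia.
  by exists (inl (Ordinal ltk)); rewrite /= prednK // class_refl.
have ltk : (2 * m - a).-1 < m.-1 by lia.
exists (inl (Ordinal ltk)); rewrite rot_class /= prednK; last by lia.
rewrite [X in _ || X]eq_sym eq_invg_mul -expgD subnK; last exact: ltnW.
by rewrite -ox expg_order eqxx orbT.
Qed.

Definition dic_class k : CCC G :=
  exist (fun C => C \in noncentral_classes G) (dic_rep k ^: G)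
    (imset_f (fun z => z ^: G) (dic_rep_noncentral k)).

Lemma dic_class_bij : bijective dic_class.
Proof.
have inj : injective dic_class.
  by move=> k l [e]; apply: dic_rep_inj; rewrite -e class_refl.
apply: inj_card_bij => //.
rewrite -(card_codom inj); apply: subset_leq_card; apply/subsetP => -[C CP] _.
case/imsetP: (CP) => z /dic_rep_surj[k zk] eC; apply/codomP; exists k.
by apply: val_inj; rewrite /= eC; apply/class_eqP.
Qed.

Lemma dic_class_adj k l : adj (dic_class k) (dic_class l) =
  match k, l with
  | inl i, inl j => i != j
  | inr r, inr s => (r != s) && odd m
  | _, _ => false
  end.
Proof.
have rotNref (i : 'I_m.-1) (r : 'I_2) :
    adj (dic_class (inl i)) (dic_class (inr r)) = false.
  apply/negP => /andP[_ /exists_inP[z /= zi /exists_inP[_ /ref_class[q ->]]]].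
  have mNi : ~~ (m %| i.+1).
    by apply/negP => /(dvdn_leq (ltn0Sn _)); have := ltn_ord i; lia.
  move/eqP=> zc; case/negP: mNi; rewrite -(commute_rot_ref _ (r + 2 * q)).
  apply/eqP; move: zi zc; rewrite rot_class => /orP[]/eqP-> //.
  by move=> /commute_sym/commuteV/commute_sym; rewrite invgK.
case: k l => [i|r] [j|s] //; [|by rewrite adj_sym|].
  rewrite /= /ccc_adj (inj_eq (bij_inj dic_class_bij)).
  rewrite -[RHS]andbT; congr (_ && _).
  apply/exists_inP; exists (x ^+ i.+1); first exact: class_refl.
  apply/exists_inP; exists (x ^+ j.+1); first exact: class_refl.
  by apply/eqP/commuteX2.
rewrite /= /ccc_adj (inj_eq (bij_inj dic_class_bij)).
case: (eqVneq r s) => [-> | rs]; first by rewrite eqxx.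
rewrite (_ : inr r == inr s = false) /=; last first.
  by apply/negP => /eqP[/eqP]; apply/negP.
apply/exists_inP/idP =>
  [[_ /ref_class[k ->] /exists_inP[_ /ref_class[l ->]]] | m_odd].
  (* For even m, congruence modulo m preserves parity, so commuting elements would force r = s. *)
  rewrite commute_ref_ref; apply: contraLR => m_even; apply: contra rs => e.
  have: odd r = odd s.
    have m2 : m = (2 * m./2)%N by lia.
    move/eqP/(congr1 odd): e; rewrite m2 !odd_modn_double.
    by rewrite !mul2n !oddD !odd_double !addbF.
  by case: r s {e} => -[|[|r]] //= lr [[|[|s]]] //= ls _; apply/eqP/val_inj.
(* m is odd, so r + s (m + 1) and s + r (m + 1) agree mod m and have the
   parities of r and s. *)
exists (x ^+ (r + 2 * (s * m.+1./2)) * y); first by apply/ref_class; eexists.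
apply/exists_inP; exists (x ^+ (s + 2 * (r * m.+1./2)) * y).
  by apply/ref_class; eexists.
rewrite commute_ref_ref !(mulnCA 2) mul2n halfK /= m_odd subn0 !mulnS.
by rewrite addnCA !eqn_modDl !modnMl.
Qed.

End Dicyclic.

(** * Spectra of unions of two blocks *)

Local Open Scope ring_scope.

(** The matrix determinant lemma with the division by [t] cleared, so that [t] may be the polynomial
    'X - a. *)
Lemma det_scalar_sub_rank1 (R : comNzRingType) n (t : R) (u : 'cV_n) (v : 'rV_n) :
  \det (t%:M - u *m v) * t = (t - (v *m u) 0 0) * t ^+ n.
Proof.
(* Both sides are determinants of the bordered matrix M, cleared above or
   below its diagonal. *)
pose M : 'M_(1 + n) := block_mx 1%:M v u t%:M.
have detM : \det M = \det (t%:M - u *m v).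
  have := det_mulmx M (block_mx 1%:M (- v) 0 1%:M).
  rewrite mulmx_block !(mul1mx, mulmx1, mulmx0, addr0, mulmxN) addrC subrr.
  by rewrite det_lblock det_ublock !det1 !mul1r mulr1 addrC.
have := det_mulmx M (block_mx t%:M 0 (- u) 1%:M).
rewrite mulmx_block !(mul1mx, mulmx1, mulmx0, add0r, mulmxN).
rewrite mul_mx_scalar mul_scalar_mx subrr.
rewrite det_lblock det_ublock !det1 mulr1 detM !det_scalar expr1 => <-.
by congr (_ * _); rewrite [X in \det X]mx11_scalar det_scalar1 !mxE eqxx.
Qed.

(** The matrix bJ is a constant column times a row of ones; the extra factor 'X - a is then
    cancelled in the domain of polynomials. *)
Lemma char_poly_scalar_const (R : idomainType) n (a b : R) :
  char_poly (a%:M + const_mx b : 'M_n.+1) =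
    ('X - a%:P) ^+ n * ('X - (a + b *+ n.+1)%:P).
Proof.
apply: (mulIf (negbT (polyXsubC_eq0 a))); rewrite [RHS]mulrAC -exprSr [RHS]mulrC.
pose u : 'cV[{poly R}]_n.+1 := const_mx b%:P.
pose v : 'rV[{poly R}]_n.+1 := const_mx 1.
have := det_scalar_sub_rank1 ('X - a%:P) u v.
have -> : (v *m u) 0 0 = (b *+ n.+1)%:P.
  rewrite mxE (eq_bigr (fun=> b%:P)) => [|i _]; last by rewrite !mxE mul1r.
  by rewrite sumr_const card_ord polyCMn.
rewrite -addrA -opprD -polyCD => <-; congr (\det _ * _).
apply/matrixP=> i j; rewrite !mxE big_ord1 !mxE mulr1 polyCD polyCMn.
by rewrite mulrnBl opprD addrA.
Qed.

(** Two enumerations of [T] differ by a permutation that acts on rows and columns alike, so its sign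
    occurs twice. *)
Lemma det_reindex (R : comNzRingType) (T : finType) n (f : 'I_n -> T)
    (F : T -> T -> R) : bijective f ->
  \det (\matrix_(i < #|T|, j < #|T|) F (enum_val i) (enum_val j)) =
  \det (\matrix_(i < n, j < n) F (f i) (f j)).
Proof.
move=> bij_f; have /esym en := bij_eq_card bij_f; rewrite card_ord in en.
(* Replacing n by [#|T|] gives both matrices the same type. *)
case: n / en f bij_f => f bij_f.
have inj_s : injective (enum_rank \o f).
  exact: inj_comp enum_rank_inj (bij_inj bij_f).
pose M := \matrix_(i < #|T|, j < #|T|) F (enum_val i) (enum_val j).
have -> : \matrix_(i, j) F (f i) (f j) =
    row_perm (perm inj_s) (col_perm (perm inj_s) M).
  by apply/matrixP=> i j; rewrite !mxE !permE /= !enum_rankK.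
rewrite row_permE col_permE !det_mulmx !det_perm mulrC -mulrA odd_permV.
by rewrite -signr_addb addbb mulr1.
Qed.

Lemma char_poly_reindex (R : comNzRingType) (T : finType) n (f : 'I_n -> T)
    (F : T -> T -> R) : bijective f ->
  char_poly (\matrix_(i < #|T|, j < #|T|) F (enum_val i) (enum_val j)) =
  char_poly (\matrix_(i < n, j < n) F (f i) (f j)).
Proof.
move=> bij_f.
have := det_reindex (fun p q => 'X *+ (p == q) - (F p q)%:P) bij_f.
congr (_ = _); congr (\det _); apply/matrixP=> i j; rewrite !mxE.
  by rewrite (inj_eq enum_val_inj).
by rewrite (inj_eq (bij_inj bij_f)).
Qed.

Lemma char_poly_block_diag (R : comNzRingType) p q (A : 'M[R]_p) (B : 'M[R]_q) :
  char_poly (block_mx A 0 0 B) = char_poly A * char_poly B.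
Proof. by rewrite /char_poly char_block_diag_mx det_ublock. Qed.

(** The list [eigenvalues A] is a choice; unique factorisation fixes it up to order, which suffices
    for sums. *)
Lemma eq_eigenvalues n (A : 'M[algC]_n) (s : seq algC) :
  char_poly A = \prod_(z <- s) ('X - z%:P) -> perm_eq (eigenvalues A) s.
Proof. by rewrite eigenvaluesP => /prod_XsubC_eq. Qed.

Lemma prod_nseq_XsubC (R : comNzRingType) n (a : R) :
  \prod_(z <- nseq n a) ('X - z%:P) = ('X - a%:P) ^+ n.
Proof. by elim: n => [|n IHn]; rewrite ?big_nil // big_cons IHn exprS. Qed.

(* The part contributed to an energy with mean degree c by a block a I + b J
   of size n + 1. *)
Definition scalar_const_energy (n : nat) (a b c : rat) : rat :=
  `|a - c| *+ n + `|a + b *+ n.+1 - c|.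

Lemma sum_nseq_ratr n (a b c : rat) :
  \sum_(z <- rcons (nseq n (ratr a)) (ratr a + ratr b *+ n.+1)) `|z - ratr c| =
  ratr (scalar_const_energy n a b c) :> algC.
Proof.
rewrite big_rcons /= /scalar_const_energy rmorphD rmorphMn /= !ratr_norm.
rewrite !rmorphB rmorphD rmorphMn; congr (_ + _).
by elim: n => [|n IHn]; rewrite ?big_nil ?mulr0n //= big_cons IHn mulrS.
Qed.

Section TwoBlocks.

Variables (T : finType) (p q : nat) (f : 'I_p.+1 + 'I_q.+1 -> T).
Hypothesis bij_f : bijective f.

Lemma char_poly_two_blocks (R : idomainType) (F : T -> T -> R) a1 b1 a2 b2 :
    (forall k l, F (f k) (f l) = match k, l with
       | inl i, inl j => a1 *+ (i == j) + b1
       | inr i, inr j => a2 *+ (i == j) + b2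
       | _, _ => 0 end) ->
  char_poly (\matrix_(i < #|T|, j < #|T|) F (enum_val i) (enum_val j)) =
  ('X - a1%:P) ^+ p * ('X - (a1 + b1 *+ p.+1)%:P) *
  (('X - a2%:P) ^+ q * ('X - (a2 + b2 *+ q.+1)%:P)).
Proof.
move=> FE.
have bij_fs : bijective (f \o @split p.+1 q.+1).
  by apply: bij_comp bij_f _; exists unsplit; [apply: splitK | apply: unsplitK].
rewrite (char_poly_reindex _ bij_fs) -!char_poly_scalar_const.
rewrite -char_poly_block_diag; congr char_poly.
apply/matrixP=> i j; rewrite !mxE /= FE.
by case: (split i) => i'; rewrite !mxE; case: (split j) => j'; rewrite !mxE.
Qed.

Lemma sum_eigenvalues_two_blocks (F : T -> T -> algC) (a1 b1 a2 b2 c : rat) :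
    (forall k l, F (f k) (f l) = match k, l with
       | inl i, inl j => ratr (a1 *+ (i == j) + b1)
       | inr i, inr j => ratr (a2 *+ (i == j) + b2)
       | _, _ => 0 end) ->
  \sum_(z <- eigenvalues
      (\matrix_(i < #|T|, j < #|T|) F (enum_val i) (enum_val j)))
     `|z - ratr c| =
  ratr (scalar_const_energy p a1 b1 c + scalar_const_energy q a2 b2 c).
Proof.
move=> FE; set M := \matrix_(_, _) _.
have /eq_eigenvalues e : char_poly M = \prod_(z <-
    rcons (nseq p (ratr a1)) (ratr a1 + ratr b1 *+ p.+1) ++
    rcons (nseq q (ratr a2)) (ratr a2 + ratr b2 *+ q.+1)) ('X - z%:P).
  rewrite (char_poly_two_blocks (a1 := ratr a1) (b1 := ratr b1)
    (a2 := ratr a2) (b2 := ratr b2)); last first.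
    by move=> k l; rewrite FE; case: k l => k [] l; rewrite // rmorphD rmorphMn.
  by rewrite big_cat !big_rcons /= !prod_nseq_XsubC.
by rewrite (perm_big _ e) big_cat !sum_nseq_ratr [RHS]rmorphD.
Qed.

End TwoBlocks.

Lemma sum_eigenvalues_complete N (F : 'I_N.+1 -> 'I_N.+1 -> algC) (a b c : rat) :
    (forall i j, F i j = ratr (a *+ (i == j) + b)) ->
  \sum_(z <- eigenvalues
      (\matrix_(i < #|'I_N.+1|, j < #|'I_N.+1|) F (enum_val i) (enum_val j)))
     `|z - ratr c| =
  ratr (scalar_const_energy N a b c).
Proof.
move=> FE; set M := \matrix_(_, _) _.
have /eq_eigenvalues e : char_poly M = \prod_(z <-
    rcons (nseq N (ratr a)) (ratr a + ratr b *+ N.+1)) ('X - z%:P).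
  rewrite big_rcons /= prod_nseq_XsubC -char_poly_scalar_const.
  rewrite (char_poly_reindex _ (f := id)); last by exists id.
  congr char_poly; apply/matrixP=> i j.
  by rewrite !mxE FE rmorphD rmorphMn.
by rewrite (perm_big _ e) sum_nseq_ratr.
Qed.

(** * Degree sums, and the matrices as functions of pairs of vertices *)

Lemma degreeE (Gr : sgraph) (u : Gr) : degree u = (\sum_v adj u v)%N.
Proof.
by rewrite /degree -sum1dep_card big_mkcond; apply: eq_bigr => v _; case: adj.
Qed.

(** Ordered adjacent pairs are grouped by their underlying edge; each fibre consists of (u, v) and
    (v, u), which differ because adjacency is irreflexive. *)
Lemma handshake (Gr : sgraph) : (2 * #|edge_set Gr| = \sum_(u : Gr) degree u)%N.
Proof.
have -> : (\sum_(u : Gr) degree u =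
    \sum_(w in [set w : Gr * Gr | adj w.1 w.2]) 1)%N.
  rewrite (eq_bigr _ (fun u _ => degreeE u)) pair_bigA [RHS]big_mkcond.
  by apply: eq_bigr => w _; rewrite inE; case: adj.
rewrite (partition_big_imset (fun w : Gr * Gr => [set w.1; w.2])) /=.
rewrite mulnC -sum_nat_const; symmetry; apply: eq_bigr => _ /imsetP[[u v] uv ->].
rewrite inE /= in uv; have neq_uv : u != v.
  by apply: contraTneq uv => ->; rewrite adj_irr.
rewrite sum1_card -[RHS](_ : #|[set (u, v); (v, u)]| = 2)%N; last first.
  by rewrite cards2 xpair_eqE negb_and neq_uv.
apply: eq_card => -[u' v']; rewrite unfold_in /= !inE !xpair_eqE /=; apply/andP/idP.
  (* Each of u' and v' is u or v; irreflexivity excludes the cases u' = v'. *)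
  case=> uv' /eqP/setP euv; have := (euv u', euv v'); rewrite !inE !eqxx orbT /=.
  move=> [/esym/orP[]/eqP eu /esym/orP[]/eqP ev]; move: uv';
    by rewrite eu ev ?adj_irr ?eqxx ?orbT.
by case/orP=> /andP[/eqP-> /eqP->]; rewrite ?uv ?eqxx // adj_sym uv setUC eqxx.
Qed.

Lemma laplacian_mxE (Gr : sgraph) : laplacian_mx Gr =
  \matrix_(i, j) (fun u v : Gr => (degree u)%:R *+ (u == v) - (adj u v)%:R)
    (enum_val i) (enum_val j).
Proof. by apply/matrixP=> i j; rewrite !mxE (inj_eq enum_val_inj). Qed.

Lemma signless_laplacian_mxE (Gr : sgraph) : signless_laplacian_mx Gr =
  \matrix_(i, j) (fun u v : Gr => (degree u)%:R *+ (u == v) + (adj u v)%:R)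
    (enum_val i) (enum_val j).
Proof. by apply/matrixP=> i j; rewrite !mxE (inj_eq enum_val_inj). Qed.

(** Taking 0 as the mean lets one formula serve all three energies. *)
Lemma energyE (Gr : sgraph) : energy Gr = \sum_(z <- Spec Gr) `|z - ratr 0|.
Proof. by apply: eq_bigr => z _; rewrite rmorph0 subr0. Qed.

(** * The three energies of a complete graph on N + 1 vertices *)

Section CompleteGraphEnergies.

Variable N : nat.

Lemma complete_degree (u : complete_graph N.+1) : degree u = N.
Proof.
rewrite /degree (_ : [set v | adj u v] = [set~ u]).
  by rewrite cardsC1 card_ord.
by apply/setP=> v; rewrite !inE /= /complete_adj eq_sym.
Qed.

Lemma complete_avg_degree : avg_degree (complete_graph N.+1) = ratr N%:R.
Proof.
rewrite /avg_degree handshake (eq_bigr (fun=> N)) => [|u _]; last first.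
  exact: complete_degree.
by rewrite sum_nat_const /= card_ord natrM mulrC mulKf ?pnatr_eq0 // ratr_nat.
Qed.

(** A = J - I has eigenvalues -1, N times, and N. *)
Lemma complete_energy : energy (complete_graph N.+1) = ratr (2 * N%:R).
Proof.
rewrite energyE.
rewrite (@sum_eigenvalues_complete _ (fun u v => (u != v)%:R) (-1) 1) => [|i j].
  congr ratr; rewrite /scalar_const_energy !subr0 normrN1 mulrS addKr normr_nat.
  by rewrite mulr_natl mulr2n.
by case: eqP => _; rewrite -ratr_nat; congr ratr.
Qed.

(** L = (N+1)I - J has eigenvalues N + 1, N times, and 0, at distances 1 and N from the mean degree
    N. *)
Lemma complete_L_energy : L_energy (complete_graph N.+1) = ratr (2 * N%:R).
Proof.
rewrite /L_energy /L_Spec laplacian_mxE complete_avg_degree.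
rewrite (@sum_eigenvalues_complete _ (fun u v =>
  (degree (u : complete_graph N.+1))%:R *+ (u == v) - (u != v)%:R)
  N.+1%:R (-1)) => [|i j].
  congr ratr; rewrite /scalar_const_energy mulNrn subrr sub0r normrN normr_nat.
  by rewrite -natr1 addrAC subrr add0r normr1 mulr_natl mulr2n.
rewrite complete_degree rmorphB rmorphMn rmorph1 rmorph_nat.
by case: eqP => _; rewrite ?subr0 // -natr1 addrK.
Qed.

(** Q = (N-1)I + J has eigenvalues N - 1, N times, and 2N, again at distances 1 and N from N. *)
Lemma complete_Q_energy : Q_energy (complete_graph N.+1) = ratr (2 * N%:R).
Proof.
rewrite /Q_energy /Q_Spec signless_laplacian_mxE complete_avg_degree.
rewrite (@sum_eigenvalues_complete _ (fun u v =>
  (degree (u : complete_graph N.+1))%:R *+ (u == v) + (u != v)%:R)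
  (N%:R - 1) 1) => [|i j].
  congr ratr; rewrite /scalar_const_energy addrAC subrr sub0r normrN1.
  by rewrite mulrS addrA subrK addrK normr_nat mulr_natl mulr2n.
rewrite complete_degree rmorphD rmorphMn rmorphB rmorph1 rmorph_nat.
by case: eqP => _; rewrite ?addr0 ?subrK.
Qed.

End CompleteGraphEnergies.

(** * The disjoint union of a clique on p + 1 vertices and a pair, joined when [e] holds *)

Section TwoCliqueGraph.

Variables (Gr : sgraph) (p : nat) (e : bool) (f : 'I_p.+1 + 'I_2 -> Gr).
Hypothesis bij_f : bijective f.
Hypothesis adj_f : forall k l, adj (f k) (f l) =
  match k, l with
  | inl i, inl j => i != j
  | inr r, inr s => (r != s) && e
  | _, _ => false
  end.

Lemma two_clique_card : #|Gr| = p.+3.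
Proof. by rewrite -(bij_eq_card bij_f) card_sum !card_ord addn2. Qed.

Lemma two_clique_degree k : degree (f k) = if k is inl _ then p else e.
Proof.
rewrite degreeE (reindex f) /=; last exact: onW_bij.
have sum_neq n (i : 'I_n.+1) : (\sum_(j < n.+1) (i != j) = n)%N.
  rewrite (bigD1 i) //= eqxx add0n (eq_bigr (fun=> 1%N)) => [|j].
    by rewrite sum1_card cardC1 card_ord.
  by rewrite eq_sym => ->.
rewrite big_sumType /=; under eq_bigr do rewrite adj_f.
under [X in (_ + X)%N]eq_bigr do rewrite adj_f.
case: k => [i|r]; first by rewrite sum_neq big1_eq addn0.
rewrite big1_eq add0n; case: (e).
  by under eq_bigr do rewrite andbT; rewrite sum_neq.
by under eq_bigr do rewrite andbF; rewrite big1_eq.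
Qed.

Definition two_clique_avg : rat := (p%:R * p.+1%:R + 2 * e%:R) / p.+3%:R.

Lemma two_clique_avg_degree : avg_degree Gr = ratr two_clique_avg.
Proof.
rewrite /avg_degree handshake two_clique_card (reindex f) /=; last exact: onW_bij.
rewrite (eq_bigr _ (fun k _ => two_clique_degree k)) big_sumType /=.
rewrite !sum_nat_const !card_ord.
rewrite natrD !natrM /two_clique_avg [RHS]fmorph_div.
rewrite [in RHS]rmorphD [in RHS]rmorphM [X in _ = (_ + X) * _]rmorphM !rmorph_nat.
by rewrite [p%:R * _]mulrC.
Qed.

Lemma two_clique_energy : energy Gr =
  ratr (scalar_const_energy p (-1) 1 0 + scalar_const_energy 1 (- e%:R) e%:R 0).
Proof.
rewrite energyE (@sum_eigenvalues_two_blocks _ _ _ _ bij_f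
  (fun u v => (adj u v)%:R) (-1) 1 (- e%:R) e%:R) //.
move=> [i|r] [j|s]; rewrite adj_f //; case: eqP => _.
- by rewrite addNr [RHS]rmorph0.
- by rewrite mulr0n add0r [RHS]rmorph1.
- by rewrite addNr [RHS]rmorph0.
by rewrite mulr0n add0r [RHS]rmorph_nat.
Qed.

(** Adding the degrees to -A gives the blocks (p+1)I - J and 2eI - eJ. *)
Lemma two_clique_L_energy : L_energy Gr =
  ratr (scalar_const_energy p p.+1%:R (-1) two_clique_avg +
        scalar_const_energy 1 (2 * e%:R) (- e%:R) two_clique_avg).
Proof.
rewrite /L_energy /L_Spec laplacian_mxE two_clique_avg_degree.
rewrite (@sum_eigenvalues_two_blocks _ _ _ _ bij_f
  (fun u v => (degree u)%:R *+ (u == v) - (adj u v)%:R)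
  p.+1%:R (-1) (2 * e%:R) (- e%:R)) //.
move=> k l; rewrite two_clique_degree adj_f (inj_eq (bij_inj bij_f)).
case: k l => [i|r] [j|s]; rewrite ?mulr0n ?subr0 //.
  rewrite -[inl i == _]/(i == j); case: eqP => _.
    by rewrite subr0 -natr1 addrK [RHS]rmorph_nat.
  by rewrite !mulr0n !sub0r [RHS]rmorphN1.
rewrite -[inr r == _]/(r == s); case: eqP => _.
  by rewrite subr0 mulr_natl mulr2n addrK [RHS]rmorph_nat.
by rewrite !mulr0n !sub0r [RHS]rmorphN [in RHS]rmorph_nat.
Qed.

(** The blocks are (p-1)I + J and eJ: on the pair, the degree e fills the diagonal, whence the
    coefficient 0. *)
Lemma two_clique_Q_energy : Q_energy Gr =
  ratr (scalar_const_energy p (p%:R - 1) 1 two_clique_avg +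
        scalar_const_energy 1 0 e%:R two_clique_avg).
Proof.
rewrite /Q_energy /Q_Spec signless_laplacian_mxE two_clique_avg_degree.
rewrite (@sum_eigenvalues_two_blocks _ _ _ _ bij_f
  (fun u v => (degree u)%:R *+ (u == v) + (adj u v)%:R)
  (p%:R - 1) 1 0 e%:R) //.
move=> k l; rewrite two_clique_degree adj_f (inj_eq (bij_inj bij_f)).
case: k l => [i|r] [j|s]; rewrite ?mulr0n ?addr0 //.
  rewrite -[inl i == _]/(i == j); case: eqP => _.
    by rewrite addr0 subrK [RHS]rmorph_nat.
  by rewrite !mulr0n !add0r [RHS]rmorph1.
rewrite mul0rn add0r [RHS]rmorph_nat -[inr r == _]/(r == s).
by case: eqP => _; rewrite ?addr0 ?mulr0n ?add0r.
Qed.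

End TwoCliqueGraph.

(** * Comparison of the rational values with 2(p + 2), the value for the complete graph *)

Lemma scalar_const_energyE n a b c : scalar_const_energy n a b c =
  `|a - c| * n%:R + `|a + b * (n%:R + 1) - c|.
Proof. by rewrite natr1 !mulr_natr. Qed.

(** The left side is 2p + 2e, at most 2p + 2. *)
Lemma energy_value_lt p (e : bool) : scalar_const_energy p (-1) 1 0 +
  scalar_const_energy 1 (- e%:R) e%:R 0 < 2 * p.+2%:R.
Proof.
rewrite !scalar_const_energyE -(addn2 p) natrD; have := ler0n rat p.
move: (p%:R) => P P_ge0; rewrite !subr0 normrN1 mul1r mul1r.
rewrite [- 1 + _]addrC addrK [`|P|]ger0_norm //.
case: e; last by rewrite !mulr0n ?oppr0 ?mul0r ?addr0 ?normr0; lra.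
by rewrite ?mulr1n ?normrN1 ?mul1r ?normr1; lra.
Qed.

Definition L_energy_value p (e : bool) : rat :=
  scalar_const_energy p p.+1%:R (-1) (two_clique_avg p e) +
  scalar_const_energy 1 (2 * e%:R) (- e%:R) (two_clique_avg p e).

Definition Q_energy_value p (e : bool) : rat :=
  scalar_const_energy p (p%:R - 1) 1 (two_clique_avg p e) +
  scalar_const_energy 1 0 e%:R (two_clique_avg p e).

Lemma L_energy_value_lt p : (p <= 2)%N -> L_energy_value p (odd p) < 2 * p.+2%:R.
Proof. by case: p => [|[|[|]]] // _; vm_compute. Qed.

(** For m = 5 the mean degree is 7/3, and the terms are 5 + 7/3 + 1/3 + 7/3. *)
Lemma L_energy_value_eq : L_energy_value 3 true = 2 * 5.
Proof. by apply/eqP; vm_compute. Qed.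

(** Multiplied by p + 3, the difference is 4(p^2 - p - 3) for e = 0 and 4(p - 3)(p + 1) for e =
    1. *)
Lemma L_energy_value_gt p e : (4 <= p)%N -> 2 * p.+2%:R < L_energy_value p e.
Proof.
rewrite -(ler_nat rat) /L_energy_value /two_clique_avg !scalar_const_energyE.
rewrite -(addn3 p) -(addn2 p) -(addn1 p) !natrD.
move: (p%:R) => P P4; have P3 : 0 < P + 3 by lra.
have P3n : P + 3 != 0 by rewrite gt_eqF.
set d := _ / _; have dE : d * (P + 3) = P * (P + 1) + 2 * e%:R by rewrite divfK.
(* The bounds 2 <= d <= P + 1 settle the sign inside every absolute value. *)
have d_le : d <= P + 1 by rewrite -(ler_pM2r P3) dE; case: e {d dE} => /=; nra.
have d_ge : 2 <= d by rewrite -(ler_pM2r P3) dE; case: e {d dE d_le} => /=; nra.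
move: d dE d_le d_ge => d dE d_le d_ge.
have -> : P + 1 + -1 * (P + 1) - d = - d by ring.
have -> : 2 * e%:R + - e%:R * (1 + 1) - d = - d by ring.
rewrite normrN [`|P + 1 - d|]ger0_norm ?[`|d|]ger0_norm; try lra.
rewrite ler0_norm; last by case: e {dE} => /=; lra.
rewrite -(ltr_pM2r P3); case: e dE => /= dE; nra.
Qed.

Lemma Q_energy_value_lt p : (p <= 5)%N -> Q_energy_value p (odd p) < 2 * p.+2%:R.
Proof. by case: p => [|[|[|[|[|[|]]]]]] // _; vm_compute. Qed.

(** Multiplied by p + 3, the difference is 2(p^2 - 3p - 6) for e = 0 and 2(p^2 - 5p - 8) for e = 1.
    The latter is still negative at p = 6, hence the bound 6 + e; when e is the parity of p, this
    bound amounts to p >= 6. *)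
Lemma Q_energy_value_gt p (e : bool) :
  (6 + e <= p)%N -> 2 * p.+2%:R < Q_energy_value p e.
Proof.
rewrite -(ler_nat rat) /Q_energy_value /two_clique_avg !scalar_const_energyE.
rewrite -(addn3 p) -(addn2 p) -?(addn1 p) !natrD.
move: (p%:R) => P P6; have P3 : 0 < P + 3 by case: e P6 => /=; lra.
have P3n : P + 3 != 0 by rewrite gt_eqF.
set d := _ / _; have dE : d * (P + 3) = P * (P + 1) + 2 * e%:R by rewrite divfK.
have d_le : d <= P - 1 by rewrite -(ler_pM2r P3) dE; case: e P6 {d dE} => /=; nra.
have d_ge : 2 <= d by rewrite -(ler_pM2r P3) dE; case: e P6 {d dE d_le} => /=; nra.
move: d dE d_le d_ge => d dE d_le d_ge.
rewrite [`|P - 1 - d|]ger0_norm; last by lra.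
rewrite [`|P - 1 + _ - d|]ger0_norm; last by lra.
rewrite !ler0_norm; [|case: e P6 {dE} => /=; lra..].
(* Clearing the denominator produces d P (P + 3); [nra] receives [dE] times P to eliminate it. *)
have := congr1 (fun c => c * P) dE; rewrite -(ltr_pM2r P3) /=.
by case: e P6 dE => /= P6 dE dEP; nra.
Qed.

Local Close Scope ring_scope.

Theorem theorem5p2 (gT : finGroupType) (G : {group gT}) (m : nat)
    (m_ge2 : (2 <= m)%N) (Q4m : is_dicyclic G m) :
  [/\ (m = 2 \/ m = 3 \/ m = 4 ->
        [/\ ~ hyperenergetic (CCC G) /\ ~ borderenergetic (CCC G),
            ~ L_hyperenergetic (CCC G) /\ ~ L_borderenergetic (CCC G) &
            ~ Q_hyperenergetic (CCC G) /\ ~ Q_borderenergetic (CCC G)]),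
      (m = 5 ->
        [/\ ~ hyperenergetic (CCC G) /\ ~ borderenergetic (CCC G),
            ~ L_hyperenergetic (CCC G) /\ L_borderenergetic (CCC G) &
            ~ Q_hyperenergetic (CCC G) /\ ~ Q_borderenergetic (CCC G)]),
      (m = 6 \/ m = 7 ->
        [/\ ~ hyperenergetic (CCC G) /\ ~ borderenergetic (CCC G),
            L_hyperenergetic (CCC G) /\ ~ L_borderenergetic (CCC G) &
            ~ Q_hyperenergetic (CCC G) /\ ~ Q_borderenergetic (CCC G)]) &
      ((8 <= m)%N ->
        [/\ ~ hyperenergetic (CCC G) /\ ~ borderenergetic (CCC G),
            L_hyperenergetic (CCC G) /\ ~ L_borderenergetic (CCC G) &
            Q_hyperenergetic (CCC G) /\ ~ Q_borderenergetic (CCC G)])].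
Proof.
case: m m_ge2 Q4m => [|[|p]] // m_ge2 Q4m.
have [x [y [ox yNx xy defG]]] := dicyclic_generators (ltn0Sn _) Q4m.
have bij_f := dic_class_bij m_ge2 ox yNx xy defG.
have adj_f := dic_class_adj m_ge2 ox yNx xy defG.
rewrite /= negbK in adj_f.
rewrite /hyperenergetic /borderenergetic /L_hyperenergetic /L_borderenergetic.
rewrite /Q_hyperenergetic /Q_borderenergetic (two_clique_card bij_f).
rewrite complete_energy complete_L_energy complete_Q_energy.
rewrite (two_clique_energy bij_f adj_f) (two_clique_L_energy bij_f adj_f).
rewrite (two_clique_Q_energy bij_f adj_f) !ltr_rat.
rewrite -/(L_energy_value p (odd p)) -/(Q_energy_value p (odd p)).
(* Here u is the value for the graph and v that for the complete graph; as [ratr] is injective, one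
   strict comparison settles both the hyperenergetic and the borderenergetic question. *)
have ltP (u v : rat) : (u < v -> ~ v < u /\ ratr v <> ratr u :> algC)%R.
  move=> uv; split; first by apply/negP; rewrite -leNgt ltW.
  by move/fmorph_inj => vu; rewrite vu ltxx in uv.
have gtP (u v : rat) : (v < u -> v < u /\ ratr v <> ratr u :> algC)%R.
  by move=> vu; split=> // /fmorph_inj uv; rewrite uv ltxx in vu.
have E := ltP _ _ (energy_value_lt p (odd p)).
(* In terms of p the cases are p <= 2, p = 3, p = 4 or 5, and p >= 6; [E] closes the adjacency part
   of each. *)
split=> [m_small | [pE] | m_mid | m_large]; split=> //.
- by apply/ltP/L_energy_value_lt; lia.
- by apply/ltP/Q_energy_value_lt; lia.
- by rewrite pE L_energy_value_eq ltxx.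
- by apply/ltP/Q_energy_value_lt; lia.
- by apply/gtP/L_energy_value_gt; lia.
- by apply/ltP/Q_energy_value_lt; lia.
- by apply/gtP/L_energy_value_gt; lia.
- by apply/gtP/Q_energy_value_gt; lia.
Qed.
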